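(* Let $K$ be a field of characteristic $0$ and let $M$ be a $2\times(n+1)$ multiplicity matrix (columns indexed $0,\ldots,n$) of the form \[M=\begin{pmatrix}\mu_{1,0}&\mu_{1,1}&\cdots&\mu_{1,n-4}&2&1&0&0\\ \mu_{2,0}&\mu_{2,1}&\cdots&\mu_{2,n-4}&1&0&1&0\end{pmatrix},\] i.e. its last four columns are $\begin{pmatrix}2&1&0&0\\1&0&1&0\end{pmatrix}$. There exist no polynomial $f(x)\in K[x]$ and no sequence $\Lambda=(\lambda_1,\lambda_2)$ of distinct elements of $K$ such that $M=M_f(\Lambda)$.
   Context: For a polynomial $f$ of degree $d$ and a sequence $\Lambda=(\lambda_1,\ldots,\lambda_m)$ of distinct elements of $K$, the multiplicity matrix $M_f(\Lambda)$ is the $m\times(d+1)$ matrix (rows $i\in\{1,\ldots,m\}$, columns $j\in\{0,\ldots,d\}$) whose $(i,j)$ entry is the multiplicity of $\lambda_i$ as a zero of $f^{(j)}(x)$ (which is $0$ if $f^{(j)}(\lambda_i)\neq0$). An $m\times(n+1)$ multiplicity matrix is a matrix $(\mu_{i,j})$ of nonnegative integers (columns $j=0,\ldots,n$) such that each row satisfies $\mu_{i,n}=0$ and $\mu_{i,j}\ge1\Rightarrow\mu_{i,j+1}=\mu_{i,j}-1$, and $\sum_{i=1}^m\mu_{i,j}\le n-j$ for all $j$. *)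

(* Defs.v *)
From HB Require Import structures.
From mathcomp Require Export all_boot all_order all_algebra.

Set Implicit Arguments.
Unset Strict Implicit.
Unset Printing Implicit Defensive.

Import GRing.Theory.
Local Open Scope ring_scope.

Section MultiplicityMatrix.

Variables (m n : nat).

Definition is_multiplicity_matrix (M : 'M[nat]_(m, n.+1)) : Prop :=
  [/\ forall i : 'I_m, M i ord_max = 0%N,
      forall (i : 'I_m) (j k : 'I_n.+1),
        (k = j.+1 :> nat) -> (1 <= M i j)%N -> M i k = (M i j - 1)%N
    & forall j : 'I_n.+1, (\sum_(i < m) M i j <= n - j)%N].

(* This is the multiplicity matrix of f only when f has degree n, i.e.
   [size f = n.+1]; see [is_matrix_of]. *)
Definition mult_matrix (K : fieldType) (f : {poly K}) (L : m.-tuple K) :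
    'M[nat]_(m, n.+1) :=
  \matrix_(i < m, j < n.+1) mup (tnth L i) f^`(j).

(* The matrix of f has (degree of f) + 1 columns, so its equality with the
   m x (n+1) matrix M includes the equality of the degree of f with n. *)
Definition is_matrix_of (K : fieldType) (M : 'M[nat]_(m, n.+1))
    (f : {poly K}) (L : m.-tuple K) : Prop :=
  size f = n.+1 /\ M = mult_matrix f L.

(* Columns n-3, ..., n of M; [inord] does not truncate when 3 <= n. *)
Definition last_four_columns (M : 'M[nat]_(m, n.+1)) : 'M[nat]_(m, 4) :=
  \matrix_(i < m, k < 4) M i (inord (n - 3 + k)%N).

End MultiplicityMatrix.

Definition matrix_2100_1010 : 'M[nat]_(2, 4) :=
  \matrix_(i < 2, k < 4)
    nth 0%N (nth [::] [:: [:: 2; 1; 0; 0]; [:: 1; 0; 1; 0]]%N i) k.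

(* Main.v *)
Require Import Defs.
From mathcomp Require Import all_boot all_order all_algebra ring.

Import GRing.Theory.
Local Open Scope ring_scope.

(** The derivative of order [n - 3] is a cubic with a double zero at
    [lambda_1] and a simple zero at [lambda_2], i.e. a nonzero multiple of
    [(x - lambda_1)^2 (x - lambda_2)], whose second derivative is, at
    [lambda_2], a nonzero multiple of [4 (lambda_2 - lambda_1)]; the penultimate
    column requires it to vanish there. *)

(** For [k] at most the degree [d] of [f], the coefficient of index [d - k] is the leading
    coefficient of [f] times the falling factorial [d ^_ k], a positive integer and so nonzero in
    characteristic 0. *)
Lemma size_derivn_char0 (K : fieldType) (f : {poly K}) (k : nat) :
  [pchar K] =i pred0 -> size f^`(k) = (size f - k)%N.
Proof.
move=> charK; have [le_fk | lt_kf] := leqP (size f) k.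
  by rewrite derivn_poly0 // size_poly0; apply/esym/eqP.
apply/eqP; rewrite eqn_leq; apply/andP; split.
  by apply/leq_sizeP => i; rewrite leq_subLR coef_derivn => /leq_sizeP->;
     rewrite ?mul0rn.
case def_sz: (size f) lt_kf => [|d] // lt_kd; rewrite ltnS in lt_kd.
rewrite subSn // ltnNge; apply/negP => /leq_sizeP/(_ _ (leqnn _))/eqP.
rewrite coef_derivn subnKC // -mulr_natr mulf_eq0.
rewrite (proj1 (pcharf0P K) charK) -[d]/(d.+1.-1) -{1}def_sz.
rewrite -lead_coefE lead_coef_eq0 -size_poly_eq0 def_sz /=.
by rewrite -leqn0 leqNgt ffact_gt0 lt_kd.
Qed.

(** The two factors are coprime as [a != b], so their product divides [g]; both have size 4, hence
    they are associates. *)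
Lemma cubic_double_simple (K : fieldType) (g : {poly K}) (a b : K) :
    a != b -> size g = 4%N -> (2 <= mup a g)%N -> (1 <= mup b g)%N ->
  exists2 c, c != 0 & g = c *: (('X - a%:P) ^+ 2 * ('X - b%:P)).
Proof.
move=> neq_ab sz_g; have g_neq0 : g != 0 by rewrite -size_poly_gt0 sz_g.
rewrite !mup_geq // expr1 => dvd_a dvd_b.
have co_ab : coprimep (('X - a%:P) ^+ 2) ('X - b%:P).
  by rewrite coprimep_expl // coprimep_XsubC root_XsubC eq_sym.
set d := _ * _; have : d %| g by rewrite Gauss_dvdp ?dvd_a.
have sz_d : size d = 4%N.
  by rewrite size_Mmonic ?monicXsubC ?expf_neq0 ?polyXsubC_eq0 //
     size_exp_XsubC size_XsubC.
move=> dvd_g; have : d %= g by rewrite -dvdp_size_eqp // sz_d sz_g.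
case/eqpf_eq => c c_neq0 def_d; exists c^-1; first by rewrite invr_eq0.
by rewrite def_d scalerA mulVf // scale1r.
Qed.

Lemma cubic_deriv2 (K : fieldType) (a b : K) :
  ((('X - a%:P) ^+ 2 * ('X - b%:P))^`(2)).[b] = 4%:R * (b - a).
Proof.
rewrite !derivnS derivn0 expr2 !(derivM, derivD, derivN, derivX).
rewrite -polyC1 !derivC !(hornerC, hornerX, hornerM, hornerN, hornerD).
by ring.
Qed.

Theorem theorem9 (K : fieldType) (charK : [pchar K] =i pred0)
    (n : nat) (hn : (3 <= n)%N) (M : 'M[nat]_(2, n.+1))
    (hM : is_multiplicity_matrix M)
    (hlast : last_four_columns M = matrix_2100_1010) :
  ~ exists (f : {poly K}) (L : 2.-tuple K), uniq L /\ is_matrix_of M f L.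
Proof.
case=> f [L [uniqL [sz_f def_M]]].
have colE (i : 'I_2) (k : 'I_4) :
    mup (tnth L i) f^`(n - 3 + k) = matrix_2100_1010 i k.
  rewrite -hlast def_M !mxE inordK // ltnS -[leqRHS](subnK hn) leq_add2l.
  by rewrite -ltnS.
pose a := tnth L ord0; pose b := tnth L ord_max; pose g := f^`(n - 3).
have neq_ab : a != b by rewrite /a /b !(tnth_nth 0) nth_uniq ?size_tuple.
have sz_g : size g = 4%N.
  by rewrite size_derivn_char0 // sz_f subSn ?leq_subr // subKn.
have mul_a : mup a g = 2%N by have := colE ord0 ord0; rewrite addn0 mxE.
have mul_b : mup b g = 1%N by have := colE ord_max ord0; rewrite addn0 mxE.
have mul_b2 : mup b g^`(2) = 1%N.
  (* The order [n - 3 + 2] is commuted so that [iterD] leaves the two extra derivatives outermost,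
     applied to [g]. *)
  by have := colE ord_max (inord 2); rewrite mxE inordK // addnC /derivn iterD.
have [||c c_neq0 def_g] := @cubic_double_simple _ g a b neq_ab sz_g.
- by rewrite mul_a.
- by rewrite mul_b.
(* A non-root has multiplicity 0, not 1; arguing by contraposition avoids showing that the second
   derivative is nonzero. *)
have : root g^`(2) b.
  by apply: contraTT isT => /mupNroot; rewrite mul_b2.
rewrite def_g derivnZ rootE hornerZ cubic_deriv2 !mulf_eq0 (negPf c_neq0) /=.
by rewrite (proj1 (pcharf0P K) charK) subr_eq0 (eq_sym b) (negPf neq_ab).
Qed.
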